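(* Let $1<q<\infty$. Suppose $\phi:\mathbb{R}\to\mathbb{R}^+$ is unbounded, satisfies $\phi(x)=1$ for $x\le 1$, is strictly increasing on $[1,\infty)$, and satisfies $\phi(x)\ll |x|^q$, i.e. $\phi(x)/|x|^q\to 0$ as $x\to\infty$. Let $S$ be a strictly increasing sequence of positive integers of zero density that is universally $\frac{L^q}{\phi(L)}$-good. Then there exists a perturbation $\Delta$ of $S$ that is universally $L^q$-good but universally $\infty$-sweeping out in $\frac{L^q}{\phi(L)}$.
   Context: All sequences are strictly increasing sequences of positive integers, identified with their sets of values. For a set of integers $A$, $|A|$ is its cardinality and $A(N)=A\cap[1,N)$. A sequence $S$ has zero density if $|S(N)|/N\to 0$ as $N\to\infty$. A sequence $\Delta$ is a perturbation of $S$ iff $\lim_{N\to\infty}\frac{|\{(\Delta\setminus S)\cup(S\setminus\Delta)\}(N)|}{|S(N)|}=0$. All measure-preserving systems $(X,\Sigma,m,T)$ are on probability spaces and are aperiodic (free): for every $n\ge1$ the set $\{x: T^n x=x\}$ has measure zero. For a probability space $(X,\Sigma,m)$, $\frac{L^q}{\phi(L)}=\left\{f:X\to\mathbb{R}\text{ measurable}: \int_X \frac{|f|^q}{\phi(|f|)}\,dm<\infty\right\}$. Let $F$ denote a function space (such as $L^q$ or $\frac{L^q}{\phi(L)}$) defined on each probability space, and let $S=\{a_1<a_2<\cdots\}$. Then $S$ is universally $F$-good iff, for all aperiodic measure-preserving systems $(X,\Sigma,m,T)$ on probability spaces and every $f\in F$, the averages $\frac1N\sum_{n=1}^N f(T^{a_n}x)$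 converge (to a finite limit) for a.e. $x$ as $N\to\infty$. $S$ is universally $\infty$-sweeping out in $F$ if for all aperiodic measure-preserving systems $(X,\Sigma,m,T)$ on probability spaces there exists $f\in F$ such that $\sup_N \frac1N\sum_{n=1}^N f(T^{a_n}x)=\infty$ for almost every $x$.
   Formalization: In both ''universally good'' and ''universally sweeping out'', the probability spaces are required to be countably separated up to a null set (true of all standard spaces); over arbitrary probability spaces no sequence is universally sweeping out. *)

(* Defs.v *)
From HB Require Import structures.
From mathcomp Require Import all_boot all_order all_algebra finmap.
From mathcomp Require Import all_classical all_reals all_analysis.

Set Implicit Arguments.
Unset Strict Implicit.
Unset Printing Implicit Defensive.

Import Order.TTheory GRing.Theory Num.Theory.
Import numFieldNormedType.Exports.

Local Open Scope classical_set_scope.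
Local Open Scope ring_scope.

(* A sequence a_1 < a_2 < ... is encoded with indices shifted by one:
   a_n is [a n.-1]. Its set of values is [range a]. *)
Definition int_sequence (a : nat -> nat) : Prop :=
  (forall n, (0 < a n)%N) /\ {homo a : m n / (m < n)%N}.

Definition trunc_set (A : set nat) (N : nat) : set nat :=
  A `&` [set k | (1 <= k < N)%N].

(* [fset_set] has its meaning here since [trunc_set A N] is finite. *)
Definition card_below (A : set nat) (N : nat) : nat :=
  #|` fset_set (trunc_set A N)|.

Definition zero_density (R : realType) (A : set nat) : Prop :=
  ((card_below A N)%:R / N%:R : R) @[N --> \oo] --> (0 : R).

Definition perturbation_of (R : realType) (D S : set nat) : Prop :=
  ((card_below ((D `\` S) `|` (S `\` D)) N)%:R / (card_below S N)%:R : R)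
    @[N --> \oo] --> (0 : R).

Definition measure_preserving (R : realType) (d : measure_display)
    (X : measurableType d) (m : probability X R) (T : X -> X) : Prop :=
  measurable_fun [set: X] T /\
  forall A, measurable A -> m (T @^-1` A) = m A.

(* [negligible] because [set x | T^n x = x] need not be measurable. *)
Definition aperiodic (R : realType) (d : measure_display)
    (X : measurableType d) (m : probability X R) (T : X -> X) : Prop :=
  forall n, (0 < n)%N -> m.-negligible [set x | iter n T x = x].

(* Outside a null set, points are separated by countably many measurable
   sets. Every standard (Lebesgue-Rokhlin) probability space satisfies this.
   Some such condition is implicit in the pointwise definition of
   aperiodicity: the shift on the integers with the
   countable-cocountable sigma-algebra of Z * [0, 1] has no periodic point,
   yet all measurable functions are a.e. constant. *)
Definition countably_separated (R : realType) (d : measure_display)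
    (X : measurableType d) (m : probability X R) : Prop :=
  exists (E : nat -> set X) (Z : set X),
    [/\ forall n, measurable (E n),
        m.-negligible Z &
        forall x y, ~ Z x -> ~ Z y -> (forall n, E n x <-> E n y) -> x = y].

Definition aperiodic_system (R : realType) (d : measure_display)
    (X : measurableType d) (m : probability X R) (T : X -> X) : Prop :=
  [/\ countably_separated m, measure_preserving m T & aperiodic m T].

Definition seq_average (R : realType) (X : Type) (T : X -> X)
    (a : nat -> nat) (f : X -> R) (x : X) (N : nat) : R :=
  N%:R^-1 * \sum_(0 <= n < N) f (iter (a n) T x).

Definition function_space (R : realType) : Type :=
  forall (d : measure_display) (X : measurableType d) (m : probability X R),
    set (X -> R).

Definition Lq_space (R : realType) (q : R) : function_space R :=
  fun d X m => [set f : X -> R | f \in Lfun m q%:E].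

Definition Lq_phi_space (R : realType) (q : R) (phi : R -> R) :
    function_space R :=
  fun d X m => [set f : X -> R | measurable_fun [set: X] f /\
    (\int[m]_x ((`|f x| `^ q / phi `|f x|)%:E) < +oo)%E].

Definition universally_good (R : realType) (F : function_space R)
    (a : nat -> nat) : Prop :=
  forall (d : measure_display) (X : measurableType d) (m : probability X R)
    (T : X -> X), aperiodic_system m T ->
  forall f : X -> R, F d X m f ->
    {ae m, forall x, cvg (seq_average T a f x N @[N --> \oo])}.

Definition universally_sweeping_out (R : realType) (F : function_space R)
    (a : nat -> nat) : Prop :=
  forall (d : measure_display) (X : measurableType d) (m : probability X R)
    (T : X -> X), aperiodic_system m T ->
  exists2 f : X -> R, F d X m f &
    {ae m, forall x,
      ereal_sup [set (seq_average T a f x N)%:E | N in [set N | (0 < N)%N]]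
        = +oo%E}.

(* Main.v *)
(* The perturbation adds to [range a] blocks [blk j], each an arithmetic
   progression of difference [K] in a residue class [r] modulo [K], placed at a
   position [n j] where [|range a|] at most doubles over the span of the block
   (such positions exist by zero density) and so that all blocks up to the [j]-th
   together have size about [|range a `&` [1, n j)| / M]. Stage [p] runs through
   all residues [r < K p] with [M = M p].

   For [f] in [L^q], the contribution of the blocks to the averages is dominated
   by functions [g_j] with [|g_j|_q <= |f|_q / M], and [sum_p K p / M p ^ q] is
   finite, so [g_j --> 0] a.e.: the perturbed averages converge with the
   original ones. For the sweeping out, take [f = c p] on a set [E p] of measure
   at most [1 / K p] with the property that for most [x] there is a residue [r]
   such that [T^k x] lies in [E p] for all [k = r] modulo [K p] in a long initial
   range. The block of that residue forces an average of order
   [c p / M p = 2 ^ p], whereas [c p ^ q / (phi (c p) * K p)] is summable; the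
   unboundedness of [phi] lets both summability conditions hold together. *)

Require Import Defs.
From HB Require Import structures.
From mathcomp Require Import all_boot all_order all_algebra finmap.
From mathcomp Require Import all_classical all_reals all_analysis.
From mathcomp Require Import measurable_realfun measurable_fun_approximation.
From mathcomp Require Import zify ring lra.

Set Implicit Arguments.
Unset Strict Implicit.
Unset Printing Implicit Defensive.

Import Order.TTheory GRing.Theory Num.Theory.
Import numFieldNormedType.Exports.

Local Open Scope classical_set_scope.
Local Open Scope ring_scope.

(** * Enumerations of sets of integers *)

(** A sorted list, so that it can index sums. It starts at 0, unlike [trunc_set], whence the
    hypothesis [~ A 0] in the comparison with [card_below]. *)
Definition elements_below (A : set nat) (N : nat) : seq nat :=
  [seq k <- iota 0 N | k \in A].

Lemma mem_elements_below A N k :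
  (k \in elements_below A N) = (k \in A) && (k < N)%N.
Proof. by rewrite mem_filter mem_iota. Qed.

Lemma elements_below_uniq A N : uniq (elements_below A N).
Proof. by rewrite filter_uniq // iota_uniq. Qed.

Lemma card_below_size (A : set nat) N : ~ A 0%N ->
  card_below A N = size (elements_below A N).
Proof.
move=> A0; have finA : finite_set (trunc_set A N).
  apply: (sub_finite_set _ (finite_II N)) => k [_] /=.
  by case/andP.
have eqA : fset_set (trunc_set A N) =i elements_below A N.
  move=> k; rewrite in_fset_set // mem_elements_below.
  apply/idP/andP => [|[]]; rewrite !inE.
    by case=> Ak /= /andP[_ ?]; split; rewrite ?inE.
  move=> Ak kN; split=> //=; rewrite kN andbT lt0n.
  by apply/eqP => k0; apply: A0; rewrite -k0.
rewrite /card_below; apply/perm_size/uniq_perm; rewrite ?elements_below_uniq //.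
Qed.

Lemma elements_below_leq A m n : (m <= n)%N ->
  (size (elements_below A m) <= size (elements_below A n))%N.
Proof.
move=> mn; rewrite uniq_leq_size ?elements_below_uniq // => k.
by rewrite !mem_elements_below => /andP[-> /leq_trans]; apply.
Qed.

Lemma int_sequence_ge (a : nat -> nat) n : int_sequence a -> (n < a n)%N.
Proof.
by case=> a0 ainc; elim: n => [|n ih] //; rewrite (leq_ltn_trans ih)// ainc.
Qed.

Lemma int_sequence_leq (a : nat -> nat) : int_sequence a ->
  {mono a : m n / (m < n)%N}.
Proof. by case=> _ ainc; apply/leqW_mono/leq_mono. Qed.

(** Both lists are strictly increasing, hence determined by their elements. *)
Lemma elements_below_range (a : nat -> nat) M c : int_sequence a ->
  (forall n, (n < c)%N = (a n < M)%N) ->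
  elements_below (range a) M = map a (iota 0 c).
Proof.
move=> sa cP; apply: (irr_sorted_eq ltn_trans ltnn).
- by rewrite sorted_filter ?iota_ltn_sorted//; exact: ltn_trans.
- rewrite sorted_map; apply: (sub_sorted _ (iota_ltn_sorted 0 c)) => i j /=.
  by rewrite int_sequence_leq.
move=> k; rewrite mem_elements_below; apply/andP/mapP => [[]|[n]].
  by rewrite inE => -[n _ <-]; rewrite -cP => nc; exists n => //; rewrite mem_iota.
by rewrite mem_iota /= add0n cP => anM ->; split=> //; rewrite inE; exists n.
Qed.

Lemma below_index (a : nat -> nat) M : int_sequence a ->
  forall n, (n < size (elements_below (range a) M))%N = (a n < M)%N.
Proof.
move=> sa; have exM : exists n, (M <= a n)%N.
  by exists M; apply/ltnW/int_sequence_ge.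
have cP : forall n, (n < ex_minn exM)%N = (a n < M)%N.
  move=> n; case: ex_minnP => c Mac cmin; apply/idP/idP => [nc|anM].
    by rewrite ltnNge; apply/negP => /cmin; rewrite leqNgt nc.
  rewrite -(int_sequence_leq sa); exact: leq_trans anM Mac.
by rewrite (elements_below_range sa cP) size_map size_iota.
Qed.

Lemma sum_elements_below (V : nmodType) (a : nat -> nat) (g : nat -> V) M :
  int_sequence a ->
  \sum_(k <- elements_below (range a) M) g k =
  \sum_(0 <= n < size (elements_below (range a) M)) g (a n).
Proof.
move=> sa.
by rewrite {1}(elements_below_range sa (below_index M sa)) big_map /index_iota subn0.
Qed.

Lemma size_elements_below_seq (a : nat -> nat) n : int_sequence a ->
  size (elements_below (range a) (a n)) = n.
Proof.
move=> sa; apply/eqP; rewrite eqn_leq.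
have := below_index (a n) sa n; rewrite ltnn => /negbT; rewrite -leqNgt => ->.
case: n => // n; rewrite below_index //; by case: sa => _; apply.
Qed.

(** The enumeration iterates, from 0, the map sending [n] to the least element of [D] above [n]. *)
Lemma enumerate_infinite (D : set nat) : ~ D 0%N ->
  (forall n, exists2 k, D k & (n < k)%N) ->
  exists2 b, int_sequence b & range b = D.
Proof.
move=> D0 Dinf.
have nxtP n : exists k, (k \in D) && (n < k)%N.
  by have [k Dk nk] := Dinf n; exists k; rewrite nk andbT inE.
pose nxt n := ex_minn (nxtP n).
pose b n := iter n.+1 nxt 0%N.
have nxt_gt n : D (nxt n) /\ (n < nxt n)%N.
  by rewrite /nxt; case: ex_minnP => k /andP[/set_mem].
have bP n : D (b n) /\ (iter n nxt 0 < b n)%N by exact: nxt_gt.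
have binc n : (b n < b n.+1)%N by have [] := bP n.+1.
exists b.
  split=> [n|]; first by have [] := bP n; case: (b n).
  by apply: homo_ltn => //; exact: ltn_trans.
apply/seteqP; split=> [_ [n _ <-]|k Dk]; first by have [] := bP n.
have k0 : (iter 0 nxt 0 < k)%N.
  by rewrite lt0n; apply/eqP => k0; apply: D0; rewrite -k0.
have iter_ge i : (i <= iter i nxt 0)%N.
  by elim: i => // i ih; have [_] := bP i; exact: leq_ltn_trans.
(* Any [k] in [D] falls between two consecutive iterates; minimality makes it the upper one. *)
have [n nk kn] : exists2 n, (iter n nxt 0 < k)%N & (k <= iter n.+1 nxt 0)%N.
  have : exists i, (k <= iter i nxt 0)%N by exists k.
  case=> i; elim: i => [|i ih kb]; first by rewrite leqNgt k0.
  by case: (ltnP (iter i nxt 0) k) => [?|/ih//]; exists i.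
exists n => //; apply/eqP; rewrite eqn_leq kn andbT /b iterS {1}/nxt.
by case: ex_minnP => x _; apply; rewrite nk andbT; exact/mem_set.
Qed.

(** * Positions of the blocks *)

Section Blocks.
Variable s : nat -> nat.
Hypothesis s_mono : {homo s : m n / (m <= n)%N}.
Hypothesis s_unbounded : forall c, exists n, (c <= s n)%N.
Hypothesis s_sparse :
  forall L, exists n1, forall n, (n1 <= n)%N -> (L * s n <= n)%N.

(* If [s] more than doubled on every window [n, n + L s n], iterating along
   these windows would give [n <= n0 + L s n] with [s n] arbitrarily large,
   against [(L + 1) s n <= n]. *)
Lemma slow_growth_window L n0 :
  exists2 n, (n0 <= n)%N & (s (n + L * s n) <= 2 * s n)%N.
Proof.
apply: contrapT => nex.
have fast n : (n0 <= n)%N -> (2 * s n < s (n + L * s n))%N.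
  by move=> n0n; rewrite ltnNge; apply/negP => ?; apply: nex; exists n.
have [n1 n1P] := s_sparse L.+1.
have reach i : exists n, [/\ (n0 <= n)%N, (i <= s n)%N & (n <= maxn n0 n1 + L * s n)%N]
   /\ (n1 <= n)%N.
  elim: i => [|i [n [[n0n si nle] n1n]]].
    by exists (maxn n0 n1); rewrite leq_maxl leq_addr leq_maxr.
  exists (n + L * s n)%N; have := fast _ n0n; set t := s (n + _) => ft.
  split; last by rewrite (leq_trans n1n)// leq_addr.
  split; [lia | lia |].
  have : (L * (2 * s n) <= L * t)%N by rewrite leq_mul2l (ltnW ft) orbT.
  lia.
have [n [[_ sn nle] n1n]] := reach (maxn n0 n1).+1.
have := n1P _ n1n; rewrite mulSn; lia.
Qed.

Lemma block_position L c e :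
  exists n, [/\ (e <= n)%N, (c <= s n)%N & (s (n + L * s n) <= 2 * s n)%N].
Proof.
have [n0 cn0] := s_unbounded c.
have [n] := slow_growth_window L (maxn e n0).
rewrite geq_max => /andP[en n0n] sn; exists n; split => //.
exact: leq_trans cn0 (s_mono n0n).
Qed.

(** Block [j] has [s (n j) / (2 M j)] elements, rounded down, and [n j] is so far out that the
    earlier blocks total at most [s (n j) / (2 M j)] as well. Spaced by [K j], the block fits into a
    window of length [2 K j s (n j)] on which [s] at most doubles. *)
Lemma block_construction (K M r : nat -> nat) :
  (forall j, (0 < M j)%N) -> (forall j, (r j < K j)%N) ->
  exists (n e : nat -> nat) (blk : nat -> seq nat), forall j,
  [/\ uniq (blk j) /\ (0 < size (blk j))%N,
      forall k, k \in blk j -> (n j <= k < e j)%N /\ (k %% K j)%N = r j,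
      (e j <= n j.+1)%N,
      (M j * \sum_(i < j.+1) size (blk i) <= s (n j))%N &
      (s (e j) + \sum_(i < j.+1) size (blk i) <= 12 * M j * size (blk j))%N].
Proof.
move=> M0 rK.
have [pos posP] : exists pos : nat -> nat -> nat -> nat, forall L c e,
    [/\ (e <= pos L c e)%N, (c <= s (pos L c e))%N &
        (s (pos L c e + L * s (pos L c e)) <= 2 * s (pos L c e))%N].
  exists (fun L c e => projT1 (cid (block_position L c e))) => L c e.
  by case: cid.
pose place j (et : nat * nat) := pos (2 * K j)%N (2 * M j * et.2.+1)%N et.1.
(* The state holds the end of the last block and the total size of the blocks so far. *)
pose st := fix st j := if j is i.+1 then
  let et := st i in let n := place i et in
  ((n + 2 * K i * s n)%N, (et.2 + s n %/ (2 * M i))%N) else (0, 0)%N.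
pose n j := place j (st j).
pose l j := (s (n j) %/ (2 * M j))%N.
(* The quotient is increased by one so that no element falls below [n j]. *)
pose blk j := [seq ((n j %/ K j).+1 + i) * K j + r j | i <- iota 0 (l j)]%N.
pose e j := (n j + 2 * K j * s (n j))%N.
have szblk j : size (blk j) = l j by rewrite size_map size_iota.
have sum_blk j : (\sum_(i < j) size (blk i))%N = (st j).2.
  elim: j => [|j ih]; first by rewrite big_ord0.
  by rewrite big_ord_recr /= ih szblk.
exists n, e, blk => j.
have [en sn grow] := posP (2 * K j)%N (2 * M j * (st j).2.+1)%N (st j).1.
rewrite -[pos _ _ _]/(n j) in en sn grow.
have K0 : (0 < K j)%N by apply: leq_ltn_trans (rK j).
have M1 := M0 j.
have l_le : (l j * (2 * M j) <= s (n j))%N by rewrite leq_divM.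
have l_gt : (s (n j) < (l j).+1 * (2 * M j))%N by rewrite ltn_ceil// muln_gt0.
have l0 : (0 < l j)%N.
  rewrite divn_gt0 ?muln_gt0//; apply: leq_trans sn.
  by rewrite leq_pmulr.
rewrite sum_blk /= -[place _ _]/(n j) -/(l j) szblk; split.
- split; rewrite ?szblk // map_inj_in_uniq ?iota_uniq // => x y _ _ /addIn/eqP.
  by rewrite eqn_pmul2r // eqn_add2l => /eqP.
- move=> k /mapP[i]; rewrite mem_iota /= add0n => il ->; split; last first.
    by rewrite modnMDl modn_small.
  have := divn_eq (n j) (K j); have := ltn_pmod (n j) K0.
  set d := (n j %/ K j)%N; set w := (n j %% K j)%N => wK ndw.
  have := rK j.
  have : (l j <= s (n j))%N by apply: leq_trans l_le; rewrite leq_pmulr// muln_gt0.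
  rewrite /e; nia.
- by have [+ _ _] := posP (2 * K j.+1)%N (2 * M j.+1 * (st j.+1).2.+1)%N (st j.+1).1.
- nia.
(* The left side is at most [2 s (n j) + s (n j)], and [s (n j) < (l j + 1) 2 M j <= 4 M j l j]
   because [l j > 0]: hence the constant 12. *)
rewrite -[(n j + _)%N]/(e j) in grow.
nia.
Qed.

End Blocks.

(** * Rokhlin towers *)

Section MeasurePreserving.
Context (R : realType) (d : measure_display) (X : measurableType d).
Variables (m : probability X R) (T : X -> X).
Hypothesis mT : measure_preserving m T.

Lemma measure_preserving_iter n : measure_preserving m (iter n T).
Proof.
elim: n => [|n [ihm ih]]; first by split => //=; exact: measurable_id.
have [mfT pT] := mT; split.
  by rewrite [iter _ _](_ : _ = T \o iter n T) //; exact: measurableT_comp.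
move=> A mA; rewrite [X in m X](_ : _ = iter n T @^-1` (T @^-1` A)) //.
rewrite ih ?pT // -[X in measurable X]setTI; exact: mfT.
Qed.

Lemma measurable_preimage_iter n A :
  measurable A -> measurable (iter n T @^-1` A).
Proof.
by move=> mA; rewrite -[X in measurable X]setTI; apply: (measure_preserving_iter n).1.
Qed.

Lemma measure_preimage_iter n A :
  measurable A -> m (iter n T @^-1` A) = m A.
Proof. exact: (measure_preserving_iter n).2. Qed.

Lemma negligible_preimage_iter n A :
  m.-negligible A -> m.-negligible (iter n T @^-1` A).
Proof.
move=> [B [mB B0 AB]]; exists (iter n T @^-1` B); split.
- exact: measurable_preimage_iter.
- by rewrite measure_preimage_iter.
- by move=> x; exact: AB.
Qed.

Definition visits (A : set X) := \bigcup_n (iter n T @^-1` A).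

Lemma measurable_visits A : measurable A -> measurable (visits A).
Proof.
by move=> mA; apply: bigcupT_measurable => n; exact: measurable_preimage_iter.
Qed.

Lemma visits_iter n A x : visits A (iter n T x) -> visits A x.
Proof. by case=> k _ /=; rewrite -iterD => ?; exists (k + n)%N. Qed.

(* [A] keeps of each [C k] the points whose orbit never meets an earlier [C j].
   The preimages of this part of [C k] under [T ^ i], [i <= H], are disjoint and
   fit into the points visiting [C k] but, after [H] steps, no earlier [C j];
   the measures of these sets telescope. *)
Lemma sweeping_small_set (C : nat -> set X) H :
  (forall k, measurable (C k)) ->
  (forall k i, (i < H)%N -> C k `&` iter i.+1 T @^-1` C k = set0) ->
  m.-negligible (~` \bigcup_k C k) ->
  exists A, [/\ measurable A, (m A <= (H.+1%:R^-1)%:E)%E &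
                m.-negligible (~` visits A)].
Proof.
move=> mC C_return C_cover.
pose U k := \bigcup_(j < k) visits (C j).
have mU k : measurable (U k).
  by apply: bigcup_measurable => j _; exact: measurable_visits.
pose A k := C k `\` U k.
have mA k : measurable (A k) by exact: measurableD.
have disjA k : trivIset [set: 'I_H.+1] (fun i => iter i T @^-1` A k).
  apply/trivIsetP => i j _ _.
  wlog ij : i j / (i < j)%N => [hw ne|_].
    case: (ltngtP i j) => [ij|ji|/val_inj eij].
    - exact: hw.
    - by rewrite setIC; apply: hw => //; rewrite eq_sym.
    - by rewrite eij eqxx in ne.
  rewrite -subset0 => x [[Ci _] [Cj _]].
  have lt : (j - i.+1 < H)%N by have := ltn_ord j; lia.
  suff : (C k `&` iter (j - i.+1).+1 T @^-1` C k) (iter i T x).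
    by rewrite C_return.
  split=> //=; rewrite -iterS -iterD.
  by rewrite (_ : (_ + _)%N = j) //; lia.
have UH k : iter H T @^-1` U k `<=` U k.
  by move=> x [j jk /visits_iter]; exists j.
have gain k : ((H.+1%:R)%:E * m (A k) + m (U k) <= m (U k.+1))%E.
  have mI i : measurable (iter i T @^-1` A k) by exact: measurable_preimage_iter.
  have -> : ((H.+1%:R)%:E * m (A k))%E
      = m (\big[setU/set0]_(i < H.+1) (iter i T @^-1` A k)).
    rewrite measure_semi_additive_ord //; last exact: bigsetU_measurable.
    rewrite (eq_bigr (fun=> m (A k))) => [|i _]; last exact: measure_preimage_iter.
    by rewrite sumr_const card_ord mule_natl.
  have mIU : measurable (iter H T @^-1` U k) by exact: measurable_preimage_iter.
  have mbig : measurable (\big[setU/set0]_(i < H.+1) (iter i T @^-1` A k)).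
    exact: bigsetU_measurable.
  rewrite -(measure_preimage_iter H (mU k)) -measureU //.
    apply: le_measure; rewrite ?inE //; first exact: measurableU.
    move=> x []; last by move=> /UH[j jk ?]; exists j => //=; exact: ltnW.
    rewrite -(bigcup_mkord _ (fun i => iter i T @^-1` A k)) => -[i _ [Ci _]].
    by exists k => //=; exists i.
  rewrite -subset0 => x [].
  rewrite -(bigcup_mkord _ (fun i => iter i T @^-1` A k)).
  move=> -[i /= iH [_ nU]] [j jk vj].
  apply: nU; exists j => //; apply: (@visits_iter (H - i)).
  by rewrite -iterD subnK // -ltnS.
have sumA n : (\sum_(0 <= k < n) m (A k) <= (H.+1%:R^-1)%:E)%E.
  have H0 : (0 < H.+1%:R^-1 :> R) by rewrite invr_gt0.
  rewrite -[leRHS]mule1 -lee_pdivrMl // invrK ge0_sume_distrr //.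
  apply: (@le_trans _ _ (m (U n))); last exact: probability_le1.
  elim: n => [|n ih]; first by rewrite big_nil.
  rewrite big_nat_recr //=; apply: le_trans (gain n).
  by rewrite addeC leeD2l.
exists (\bigcup_k A k); split.
- exact: bigcupT_measurable.
- apply: (@le_trans _ _ (\sum_(k <oo) m (A k))%E).
    by apply: measure_sigma_subadditive => //; exact: bigcupT_measurable.
  apply: lime_le; first exact: is_cvg_nneseries.
  by apply: nearW => n; exact: sumA.
(* For the least [k] such that the orbit of [x] meets [C k], the orbit meets no earlier [C j]
   afterwards, so this meeting takes place in [A k]. *)
apply: negligibleS C_cover => x; apply: contra_not => -[k0 _ Ck0].
have exD : exists k, `[< visits (C k) x >].
  by exists k0; apply/asboolP; exists 0%N.
case: (ex_minnP exD) => k /asboolP[n _ Cn] kmin.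
exists n => //; exists k => //; split=> // -[j /= jk] /visits_iter vj.
by have := kmin j (asboolT vj); rewrite leqNgt jk.
Qed.

(** On [hit n] the first visit to [A] is at time [n]. A positive multiple of [K] is at least [K], so
    after [j = - i] modulo [K] steps a point of [E] still has a positive time, equal to [i] modulo
    [K], to wait. Thus each of the [K] disjoint sets [P i] has measure at least [m E]. *)
Lemma measure_residue_class (A : set X) (K : nat) : (0 < K)%N -> measurable A ->
  let hit n := iter n T @^-1` A `\` \bigcup_(i < n) iter i T @^-1` A in
  let E := \bigcup_(n in [set n | (0 < n)%N /\ (n %% K)%N = 0%N]) hit n in
  measurable E /\ (m E <= (K%:R^-1)%:E)%E.
Proof.
move=> K0 mA hit E.
have mhit n : measurable (hit n).
  apply: measurableD; first exact: measurable_preimage_iter.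
  by apply: bigcup_measurable => i _; exact: measurable_preimage_iter.
have hit_uniq n n' x : hit n x -> hit n' x -> n = n'.
  wlog nn' : n n' / (n < n')%N => [hw h h'|[An _] [_ h']].
    by case: (ltngtP n n') => // nn'; [exact: hw | symmetry; exact: hw].
  by exfalso; apply: h'; exists n.
pose P i := \bigcup_(n in [set n | (0 < n)%N /\ (n %% K)%N = i]) hit n.
have mP i : measurable (P i) by apply: bigcup_measurable => n _; exact: mhit.
split; first exact: (mP 0%N).
have E_le (i : 'I_K) : (m E <= m (P i))%E.
  pose j := ((K - i) %% K)%N.
  rewrite -(measure_preimage_iter j (mP i)); apply: le_measure.
  - by rewrite inE; exact: (mP 0%N).
  - by rewrite inE; exact: measurable_preimage_iter.
  move=> x [n [n0 nK] [An hn]].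
  have jK : (j < K)%N by exact: ltn_pmod.
  have Kn : (K <= n)%N by apply: dvdn_leq => //; rewrite /dvdn nK.
  exists (n - j)%N.
    split; first by lia.
    have /eqP := modn_small (ltn_ord i); rewrite eq_sym => /eqP iK.
    rewrite [RHS]iK; apply/eqP; rewrite -(eqn_modDr j) subnK; last by lia.
    rewrite modnDmr subnKC; last exact: ltnW.
    by rewrite nK modnn.
  split; first by rewrite /= -iterD subnK //; lia.
  move=> [l /= ln]; rewrite -iterD => Al; apply: hn; exists (l + j)%N => //=; lia.
have trivP : trivIset [set: 'I_K] (fun i : 'I_K => P i).
  apply/trivIsetP => i j _ _ ij; rewrite -subset0 => x [[n [_ ni] hn]] [n' [_ nj] hn'].
  by move/eqP: ij; apply; apply: val_inj => /=; rewrite -ni -nj (hit_uniq _ _ _ hn hn').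
have K0R : 0 < (K%:R : R) by rewrite ltr0n.
rewrite -[leRHS]mule1 -lee_pdivrMl ?invr_gt0 // invrK.
have -> : (K%:R%:E * m E = \sum_(i < K) m E)%E.
  by rewrite sumr_const card_ord mule_natl.
apply: le_trans (probability_le1 m (A := \big[setU/set0]_(i < K) P i) _); last first.
  exact: bigsetU_measurable.
rewrite measure_semi_additive_ord //; last exact: bigsetU_measurable.
by apply: lee_sum => i _; exact: E_le.
Qed.

End MeasurePreserving.

Section Aperiodic.
Context (R : realType) (d : measure_display) (X : measurableType d).
Variables (m : probability X R) (T : X -> X).
Hypothesis sys : aperiodic_system m T.

(** Off a null set, [x] differs from [T^i x] for [1 <= i <= H], so some [E n] or its complement
    contains [x] but not [T^i x]. The intersection [B s] of these [H] sets contains [x] and none of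
    its next [H] iterates. There are only countably many such intersections. *)
Lemma aperiodic_cover H : exists C : nat -> set X,
  [/\ forall k, measurable (C k),
      forall k i, (i < H)%N -> C k `&` iter i.+1 T @^-1` C k = set0 &
      m.-negligible (~` \bigcup_k C k)].
Proof.
have [[E [Z [mE Z0 sepE]]] mT aT] := sys.
pose E' (p : nat * bool) := if p.2 then E p.1 else ~` E p.1.
have mE' p : measurable (E' p) by rewrite /E'; case: p.2 => //; exact: measurableC.
pose B (s : seq (nat * bool)) := \big[setI/setT]_(p <- s) E' p.
have mB s : measurable (B s) by exact: bigsetI_measurable.
have BP s x : B s x <-> (forall p, p \in s -> E' p x).
  elim: s => [|p s ih]; first by rewrite /B big_nil; split.
  rewrite /B big_cons; split=> [[Ep /ih Es] p'|Es].
    by rewrite inE => /predU1P[->|/Es].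
  split; first exact: Es (mem_head _ _).
  by apply/ih => p' ps; apply: Es; rewrite inE ps orbT.
pose C s := B s `\` \bigcup_(i < H) iter i.+1 T @^-1` B s.
(* Lists are decoded from integers; an integer coding no list is given the empty one. *)
exists (fun k : nat => C (odflt [::] (choice.unpickle k))); split.
- move=> k; apply: measurableD => //; apply: bigcup_measurable => i _.
  exact: (measurable_preimage_iter mT).
- move=> k i iH; rewrite -subset0 => x [[_ nB] [Bi _]].
  by apply: nB; exists i.
apply: (@negligibleS _ _ _ _ (\bigcup_i (iter i T @^-1` Z) `|`
    \bigcup_i [set x | iter i.+1 T x = x])); last first.
  apply: negligibleU; apply: negligible_bigcup => i.
    exact: (negligible_preimage_iter mT).
  exact: aT.
move=> x; apply: contra_notP => /not_orP[nZ nfix].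
have sepx i : exists p, E' p x /\ ~ E' p (iter i.+1 T x).
  apply: contrapT => nsep; apply: nfix; exists i => //=; symmetry.
  apply: sepE => [Zx|Zx|n].
  - by apply: nZ; exists 0%N.
  - by apply: nZ; exists i.+1.
  have np b : E' (n, b) x -> E' (n, b) (iter i.+1 T x).
    by move=> Ex; apply: contrapT => nEx; apply: nsep; exists (n, b).
  split; first exact: (np true).
  by move=> Ei; apply: contrapT => /(np false); exact.
have [p pP] := choice sepx.
exists (choice.pickle (map p (iota 0 H))) => //; rewrite choice.pickleK /=; split.
  by apply/BP => _ /mapP[i _ ->]; case: (pP i).
move=> [i /= iH /BP Bi]; have [_] := pP i; apply.
by apply: Bi; apply: map_f; rewrite mem_iota.
Qed.

(* Take a set [A] that almost every point visits, but so small that most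
   points stay away from it for longer than [L] steps: [E] consists of the
   points whose first visit to [A] occurs at a positive multiple of [K], and the
   residue [r] attached to [x] is its first visit time modulo [K]. *)
Lemma residue_tower (K L : nat) (eps : R) : (0 < K)%N -> 0 < eps ->
  exists E Bad : set X, [/\ measurable E, measurable Bad,
    (m E <= (K%:R^-1)%:E)%E, (m Bad <= eps%:E)%E &
    forall x, ~ Bad x -> exists2 r, (r < K)%N &
      forall n, (n <= L)%N -> (n %% K)%N = r -> E (iter n T x)].
Proof.
move=> K0 eps0; have [_ mT _] := sys.
(* Then [L + 1] preimages of a set of measure at most [1 / (H + 1)] have total measure at most
   [eps]. *)
pose H := Num.truncn (L.+1%:R / eps).
have [C [mC C_return C_cover]] := aperiodic_cover H.
have [A [mA A_small A_visits]] := sweeping_small_set mT mC C_return C_cover.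
have [mE E_le] := measure_residue_class mT K0 mA.
set hit := (fun n : nat => _ `\` _) in mE E_le; set E := \bigcup_(n in _) _ in mE E_le.
pose Bad := ~` visits T A `|` \big[setU/set0]_(n < L.+1) iter n T @^-1` A.
have mI n : measurable (iter n T @^-1` A) by exact: (measurable_preimage_iter mT).
have mBad : measurable Bad.
  apply: measurableU; last exact: bigsetU_measurable.
  by apply: measurableC; exact: (measurable_visits mT).
exists E, Bad; split=> //.
- have mV : measurable (~` visits T A).
    by apply: measurableC; exact: (measurable_visits mT).
  have V0 : (m (~` visits T A) = 0)%E.
    exact: measure_negligible.
  have mbig : measurable (\big[setU/set0]_(n < L.+1) iter n T @^-1` A).
    exact: bigsetU_measurable.
  have U2 : (m Bad <= m (~` visits T A) +
      m (\big[setU/set0]_(n < L.+1) iter n T @^-1` A))%E by exact: measureU2.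
  rewrite V0 add0e in U2; apply: (le_trans U2).
  apply: (@le_trans _ _ (\sum_(n < L.+1) m (iter n T @^-1` A))%E).
    by apply: (@Boole_inequality _ _ _ m (fun n => iter n T @^-1` A)) => i _.
  rewrite (eq_bigr (fun=> m A)) => [|n _]; last exact: (measure_preimage_iter mT).
  have -> : (\sum_(n < L.+1) m A = L.+1%:R%:E * m A)%E.
    by rewrite sumr_const card_ord mule_natl.
  apply: (@le_trans _ _ ((L.+1%:R)%:E * (H.+1%:R^-1)%:E)%E).
    by rewrite lee_pmul2l.
  rewrite -EFinM lee_fin ler_pdivrMr // mulrC -ler_pdivrMr //.
  exact/ltW/truncnS_gt.
move=> x /not_orP[/contrapT[n0 _ An0] nA].
have exA : exists n, `[< A (iter n T x) >] by exists n0; exact/asboolP.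
case: (ex_minnP exA) => h /asboolP Ah hmin.
have Lh : (L < h)%N.
  rewrite ltnNge; apply/negP => hL; apply: nA.
  by rewrite -(bigcup_mkord _ (fun n => iter n T @^-1` A)); exists h.
exists (h %% K)%N; first exact: ltn_pmod.
(* As [n <= L < h], the point [T^n x] first visits [A] at time [h - n > 0], a multiple of [K]. *)
move=> n nL nK; exists (h - n)%N.
  split; first by lia.
  apply/eqP; rewrite -(mod0n K) -(eqn_modDr n) subnK ?add0n ?nK//; lia.
split; first by rewrite /= -iterD subnK //; lia.
move=> [l /= lh]; rewrite -iterD => Al.
have := hmin (l + n)%N (asboolT Al); lia.
Qed.

End Aperiodic.

(** * Sums along orbits *)

Lemma powR_sum_bounded_cvg0 (R : realType) (u : nat -> R) (q B : R) :
  0 < q -> (forall j, 0 <= u j) ->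
  (forall J, \sum_(0 <= j < J) u j `^ q <= B) -> u @ \oo --> (0 : R).
Proof.
move=> q0 u0 uB; have uq : (fun j => u j `^ q) @ \oo --> (0 : R).
  apply: cvg_series_cvg_0; apply: nondecreasing_is_cvgn.
    by apply: nondecreasing_series => j _; rewrite powR_ge0.
  by exists B => _ [J _ <-]; exact: uB.
apply/cvgr0Pnorm_lt => e e0.
have eq0 : 0 < e `^ q by rewrite powR_gt0.
have /cvgr0Pnorm_lt/(_ _ eq0) := uq; apply: filterS => j.
rewrite !ger0_norm ?powR_ge0 // => uj; rewrite ltNge; apply/negP => eu.
by move: uj; rewrite ltNge ge0_ler_powR ?nnegrE ?(ltW q0) ?(ltW e0).
Qed.

Definition orbit_sum (R : numDomainType) (X : Type) (T : X -> X) (f : X -> R)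
  (l : seq nat) (x : X) : R := \sum_(k <- l) `|f (iter k T x)|.

Section OrbitSums.
Context (R : realType) (d : measure_display) (X : measurableType d).
Variables (m : probability X R) (T : X -> X).
Hypothesis mT : measure_preserving m T.

Lemma ge0_integral_iter n (g : X -> \bar R) : measurable_fun [set: X] g ->
  (forall x, 0 <= g x)%E -> (\int[m]_x g (iter n T x) = \int[m]_x g x)%E.
Proof.
move=> mg g0; have [mTn pTn] := measure_preserving_iter mT n.
transitivity (\int[pushforward m (iter n T)]_x g x)%E.
  by rewrite ge0_integral_pushforward.
by apply: eq_measure_integral => A mA _; exact: pTn.
Qed.

Lemma Lnorm_iter n (q : R) (g : X -> \bar R) : measurable_fun [set: X] g ->
  Lnorm m q%:E (g \o iter n T) = Lnorm m q%:E (g).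
Proof.
move=> mg; rewrite unlock /=; congr poweR.
rewrite (ge0_integral_iter n (g := fun x => `|g x| `^ q)%E) //.
- by apply: (measurableT_comp (measurable_poweR _)); exact: measurableT_comp.
- by move=> x; exact: poweR_ge0.
Qed.

Variables (q : R) (f : X -> R).
Hypotheses (q1 : 1 <= q) (mf : measurable_fun [set: X] f).
Local Notation orbit_sum := (orbit_sum T f).

Lemma measurable_orbit_sum l : measurable_fun [set: X] (orbit_sum l).
Proof.
apply: measurable_sum => k; apply: measurableT_comp => //.
by apply: measurableT_comp => //; exact: (measure_preserving_iter mT k).1.
Qed.

(** Minkowski's inequality, by induction on [l]: every [f \o iter k T] has the same norm as [f]. *)
Lemma integral_orbit_sum_le (l : seq nat) :
  (\int[m]_x ((orbit_sum l x) `^ q)%:E <=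
   ((size l)%:R `^ q)%:E * \int[m]_x (`|f x| `^ q)%:E)%E.
Proof.
have q0 : q != 0 by rewrite gt_eqF // (lt_le_trans ltr01).
have norm_le : (Lnorm m q%:E (EFin \o orbit_sum l) <=
    ((size l)%:R)%:E * Lnorm m q%:E (EFin \o f))%E.
  elim: l => [|k l ih] /=.
    rewrite mul0e (_ : _ \o _ = cst 0%E) ?Lnorm0 ?eqe //.
    by apply/funext => x; rewrite /= /orbit_sum big_nil.
  rewrite (_ : _ \o orbit_sum _ =
      EFin \o ((fun x => `|f (iter k T x)|) \+ orbit_sum l)); last first.
    by apply/funext => x; rewrite /= /orbit_sum big_cons.
  have mfk : measurable_fun [set: X] (fun x => f (iter k T x)).
    by apply: measurableT_comp => //; exact: (measure_preserving_iter mT k).1.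
  apply: (le_trans (minkowski_EFin _ _ _ q1)).
  - exact: measurableT_comp.
  - exact: measurable_orbit_sum.
  rewrite -nat1r EFinD ge0_muleDl // mul1e leeD //.
  rewrite (_ : EFin \o (fun x => _) = abse \o ((EFin \o f) \o iter k T)) //.
  by rewrite Lnorm_abse Lnorm_iter //; exact/measurable_EFinP.
have -> : (\int[m]_x ((orbit_sum l x) `^ q)%:E =
    Lnorm m q%:E (EFin \o orbit_sum l) `^ q)%E.
  rewrite powR_Lnorm //; apply: eq_integral => x _ /=.
  by rewrite ger0_norm // sumr_ge0.
have -> : (\int[m]_x (`|f x| `^ q)%:E = Lnorm m q%:E (EFin \o f) `^ q)%E.
  by rewrite powR_Lnorm.
rewrite -poweR_EFin -poweRM ?Lnorm_ge0 //.
apply: gt0_ler_poweR => //; rewrite ?(le_trans ler01) // in_itv /= leey andbT.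
  exact: Lnorm_ge0.
by rewrite mule_ge0 // Lnorm_ge0.
Qed.

(** The integral of the [q]-th power of the [j]-th quotient is at most [(1 / M j) ^ q] times that of
    [|f| ^ q]. The series of these powers is therefore integrable, so finite almost everywhere, and
    its terms tend to 0. *)
Lemma orbit_sum_cvg0 (l : nat -> seq nat) (s M : nat -> nat) (c : R) :
  f \in Lfun m q%:E ->
  (forall j, (0 < s j)%N /\ (0 < M j)%N /\ (M j * size (l j) <= s j)%N) ->
  (forall J, \sum_(0 <= j < J) (M j)%:R^-1 `^ q <= c) ->
  {ae m, forall x, (orbit_sum (l j) x / (s j)%:R) @[j --> \oo] --> (0 : R)}.
Proof.
move=> fL sM c_le.
have q0 : 0 < q by rewrite (lt_le_trans ltr01).
pose I := (\int[m]_x (`|f x| `^ q)%:E)%E.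
have I0 : (0 <= I)%E by apply: integral_ge0 => x _; rewrite lee_fin powR_ge0.
have I_fin : I \is a fin_num.
  by apply: integrable_fin_num => //; exact: Lfun_integrable.
pose g j x := ((orbit_sum (l j) x / (s j)%:R) `^ q)%:E.
have o0 j x : 0 <= orbit_sum (l j) x by rewrite sumr_ge0.
have g0 j x : (0 <= g j x)%E by rewrite lee_fin powR_ge0.
have mg j : measurable_fun [set: X] (g j).
  apply/measurable_EFinP.
  apply: (measurableT_comp (measurable_powR _)).
  by apply: measurable_funM => //; exact: measurable_orbit_sum.
have int_g j : (\int[m]_x g j x <= ((M j)%:R^-1 `^ q)%:E * I)%E.
  have [s0 [M0 le_s]] := sM j.
  under eq_integral do rewrite /g powRM // EFinM muleC.
  rewrite ge0_integralZl_EFin ?powR_ge0 //; last 2 first.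
  - by move=> x _; rewrite lee_fin powR_ge0.
  - apply/measurable_EFinP; apply: (measurableT_comp (measurable_powR _)).
    exact: measurable_orbit_sum.
  apply: (@le_trans _ _ (((s j)%:R^-1 `^ q)%:E * (((size (l j))%:R `^ q)%:E * I))%E).
    by apply: lee_wpmul2l; [rewrite lee_fin powR_ge0 | exact: integral_orbit_sum_le].
  rewrite muleA; apply: lee_wpmul2r => //.
  rewrite -EFinM -powRM // lee_fin ge0_ler_powR ?nnegrE ?mulr_ge0 ?(ltW q0) //.
  rewrite mulrC ler_pdivrMr ?ltr0n // mulrC ler_pdivlMr ?ltr0n //.
  by rewrite -natrM ler_nat mulnC.
have c0 : 0 <= c by apply: le_trans (c_le 0%N); rewrite big_nil.
have int_sum : (\int[m]_x (\sum_(j <oo) g j x) <= c%:E * I)%E.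
  rewrite integral_nneseries //.
  apply: lime_le; first by apply: is_cvg_nneseries => j _ _; exact: integral_ge0.
  apply: nearW => J.
  apply: (@le_trans _ _ (\sum_(0 <= j < J) ((M j)%:R^-1 `^ q)%:E * I)%E).
    exact: lee_sum.
  rewrite -ge0_sume_distrl; last by move=> j _; rewrite lee_fin powR_ge0.
  by apply: lee_wpmul2r => //; rewrite sumEFin lee_fin.
have mG : measurable_fun [set: X] (fun x => \sum_(j <oo) g j x)%E.
  by apply: ge0_emeasurable_sum => // k _; exact: mg.
have intG : m.-integrable [set: X] (fun x => \sum_(j <oo) g j x)%E.
  apply/integrableP; split => //.
  under eq_integral do rewrite gee0_abs ?nneseries_ge0 //.
  apply: le_lt_trans int_sum _.
  by rewrite lte_mul_pinfty // ltey_eq I_fin.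
have := integrable_ae measurableT intG; apply: filterS => x /(_ Logic.I) G_fin.
apply: (@powR_sum_bounded_cvg0 _ _ q (fine (\sum_(j <oo) g j x)%E)) => //.
  by move=> j; rewrite divr_ge0.
move=> J; rewrite -lee_fin fineK // -sumEFin.
by apply: nneseries_lim_ge => n _ _; rewrite lee_fin powR_ge0.
Qed.

End OrbitSums.

(** * Choice of the parameters *)

Section Stages.
Variable K : nat -> nat.
Hypothesis K0 : forall p, (0 < K p)%N.

(** Successor in the lexicographic order of the pairs [(p, r)] with [r < K p]. *)
Definition next_stage (pr : nat * nat) : nat * nat :=
  if (pr.2.+1 < K pr.1)%N then (pr.1, pr.2.+1) else (pr.1.+1, 0%N).

Definition stage j := iter j next_stage (0, 0)%N.

Lemma stage_lt j : ((stage j).2 < K (stage j).1)%N.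
Proof. by case: j => [|j] //=; rewrite /next_stage; case: ifP. Qed.

Lemma stage_reached p r : (r < K p)%N -> exists j, stage j = (p, r).
Proof.
elim: p r => [|p ihp] r; elim: r => [|r ihr] rK.
- by exists 0%N.
- have [j jr] := ihr (ltnW rK).
  by exists j.+1; rewrite [LHS]iterS -/(stage j) jr /next_stage /= rK.
- have [j jr] := ihp (K p).-1 (eq_leq (prednK (K0 p))).
  by exists j.+1; rewrite [LHS]iterS -/(stage j) jr /next_stage /= prednK // ltnn.
- have [j jr] := ihr (ltnW rK).
  by exists j.+1; rewrite [LHS]iterS -/(stage j) jr /next_stage /= rK.
Qed.

Lemma sum_geometric_half_le2 (R : realFieldType) n :
  \sum_(0 <= i < n) 2^-1 ^+ i <= 2 :> R.
Proof.
suff -> : \sum_(0 <= i < n) 2^-1 ^+ i = 2 - 2 * 2^-1 ^+ n :> R.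
  by rewrite lerBlDr lerDl mulr_ge0 // exprn_ge0 // invr_ge0.
elim: n => [|n ih]; first by rewrite big_nil expr0; lra.
by rewrite big_nat_recr //= ih exprS; lra.
Qed.

(** Stage [p] lasts [K p] steps and contributes at most [2 ^ - p]; the unfinished last stage is
    bounded by its full contribution. *)
Lemma sum_stage_le2 (R : realFieldType) (w : nat -> R) J :
  (forall p, 0 <= w p) -> (forall p, (K p)%:R * w p <= 2^-1 ^+ p) ->
  \sum_(0 <= j < J) w (stage j).1 <= 2.
Proof.
move=> w0 Kw.
have -> : \sum_(0 <= j < J) w (stage j).1 =
    \sum_(0 <= i < (stage J).1) (K i)%:R * w i +
    (stage J).2%:R * w (stage J).1.
  elim: J => [|J ih]; first by rewrite !big_nil mul0r addr0.
  rewrite big_nat_recr //= ih -/(stage J) /next_stage.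
  have := stage_lt J; case: (stage J) => p r /= rK; case: ifPn => /= h.
    by rewrite -addrA -natr1 mulrDl mul1r.
  rewrite big_nat_recr //= mul0r addr0 -addrA; congr (_ + _).
  have -> : K p = r.+1 by apply/eqP; rewrite eqn_leq rK leqNgt h.
  by rewrite -natr1 mulrDl mul1r.
apply: le_trans (sum_geometric_half_le2 R (stage J).1.+1).
rewrite big_nat_recr //= lerD //; first exact: ler_sum.
apply: le_trans (Kw _); rewrite ler_wpM2r // ler_nat; exact/ltnW/stage_lt.
Qed.

End Stages.

Section StageChoice.
Context (R : realType) (q : R) (phi : R -> R).
Hypotheses (q_gt1 : 1 < q) (phi_gt0 : forall x, 0 < phi x)
  (phi_unbounded : forall M : R, exists x, M < phi x)
  (phi_eq1 : forall x, x <= 1 -> phi x = 1)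
  (phi_incr : forall x y, 1 <= x -> x < y -> phi x < phi y).

Lemma phi_nondecreasing : {homo phi : x y / x <= y}.
Proof.
move=> x y; rewrite le_eqVlt => /predU1P[->//|xy].
have [y1|y1] := leP y 1; first by rewrite !phi_eq1 // (le_trans (ltW xy)).
have [x1|x1] := leP x 1; last exact/ltW/phi_incr/xy/ltW.
by rewrite (phi_eq1 x1) -(phi_eq1 (lexx 1)) ltW // phi_incr.
Qed.

Lemma phi_ge1 x : 1 <= phi x.
Proof.
have [x1|x1] := leP x 1; first by rewrite phi_eq1.
by rewrite -(phi_eq1 (lexx 1)) phi_nondecreasing // ltW.
Qed.

(* Stage [p] uses test functions of height [c = 2 ^ p * M p] on sets of measure
   [1 / K p], and [K p] blocks of relative size [1 / M p]: the averages are of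
   order [2 ^ p], the [L^q / phi(L)] norms are summable since
   [c ^ q / phi c <= K p / 2 ^ p], and so are the [L^q] norms of the maximal
   functions over the blocks since [K p / M p ^ q <= 2 ^ - p]. *)
Lemma stage_parameters : exists M K : nat -> nat,
  [/\ forall p, (0 < M p)%N, {homo M : m n / (m <= n)%N},
      forall p, 2 ^+ p <= (K p)%:R :> R,
      forall p, 2 ^+ p * ((2 ^+ p * (M p)%:R) `^ q / phi (2 ^+ p * (M p)%:R))
        <= (K p)%:R &
      forall p, (K p)%:R * (M p)%:R^-1 `^ q <= 2^-1 ^+ p].
Proof.
have q0 : 0 < q by rewrite (lt_trans ltr01).
(* With [c = 2 ^ p * M p], the bound [B p <= phi c] is what makes
   [2 ^ p * (c ^ q / phi c) / M p ^ q] at most half of [2 ^ - p]. *)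
pose B p : R := 2 * 4 ^+ p * (2 ^+ p) `^ q.
have gex p : exists g,
    [/\ (0 < g)%N, 2 * 4 ^+ p <= g%:R :> R & B p <= phi g%:R].
  have [x xB] := phi_unbounded (B p).
  pose n := (Num.truncn `|x|).+1; pose l := (Num.truncn (2 * 4 ^+ p : R)).+1.
  exists (n + l)%N; split; first by rewrite addnS.
    by rewrite natrD (le_trans (ltW (truncnS_gt _))) // lerDr.
  rewrite (le_trans (ltW xB)) // phi_nondecreasing // natrD.
  rewrite (le_trans (ler_norm x)) // (le_trans (ltW (truncnS_gt _))) //.
  by rewrite lerDl.
have [g gP] := choice gex.
(* Summing makes [M] monotone and keeps [g p <= M p]. *)
pose M p := (\sum_(i < p.+1) g i)%N.
have gM p : (g p <= M p)%N by rewrite /M big_ord_recr leq_addl.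
pose c p : R := 2 ^+ p * (M p)%:R.
pose v p := 2 ^+ p * (c p `^ q / phi (c p)).
have v0 p : 0 <= v p.
  by rewrite mulr_ge0 ?exprn_ge0 // divr_ge0 ?powR_ge0 // ltW.
(* The first summand serves the [L^q / phi(L)] norm, the second the summability of [1 / K p].
   Divided by [M p ^ q], each is at most half of [2 ^ - p]. *)
exists M, (fun p => Num.truncn (v p) + 2 ^ p)%N; split.
- by move=> p; have [g0 _ _] := gP p; exact: leq_trans (gM p).
- apply: homo_leq => [//|y x z|p]; first exact: leq_trans.
  by rewrite /M [X in (_ <= X)%N]big_ord_recr leq_addr.
- by move=> p; rewrite natrD natrX lerDr.
- move=> p; rewrite -/(v p) natrD (le_trans (ltW (truncnS_gt _))) //.
  by rewrite -natr1 lerD2l natrX exprn_ege1 // ler1n.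
move=> p; have [g0 g4 gB] := gP p.
have M0 : 0 < (M p)%:R :> R by rewrite ltr0n; exact: leq_trans (gM p).
have M1 : 1 <= (M p)%:R :> R by rewrite ler1n; exact: leq_trans (gM p).
have M4 : 2 * 4 ^+ p <= (M p)%:R :> R by rewrite (le_trans g4) // ler_nat.
have cB : B p <= phi (c p).
  rewrite (le_trans gB) // phi_nondecreasing // (@le_trans _ _ (M p)%:R) ?ler_nat //.
  by rewrite ler_peMl // exprn_ege1 // ler1n.
pose u := (M p)%:R^-1 `^ q.
have u0 : 0 <= u by exact: powR_ge0.
have MqV : (M p)%:R `^ q * u = 1 by rewrite -powRM // divff ?powR1 // gt_eqF.
have uM : u <= (M p)%:R^-1.
  apply: ge1r_powR; rewrite ?(ltW q_gt1) // invr_gt0 M0 /=.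
  by rewrite invf_le1.
have a0 : 0 < 2 ^+ p :> R by rewrite exprn_gt0.
have aM : 2 ^+ p * u <= (2 * 2 ^+ p)^-1.
  apply: (@le_trans _ _ (2 ^+ p / (M p)%:R)); first by rewrite ler_pM2l.
  rewrite ler_pdivrMr // mulrC ler_pdivlMr ?mulr_gt0 //.
  by rewrite mulrCA -exprMn -natrM.
have av : v p * u <= (2 * 2 ^+ p)^-1.
  rewrite /v {1}/c powRM ?(ltW a0) ?(ltW M0) //.
  rewrite (_ : _ * u = 2 ^+ p * (2 ^+ p) `^ q / phi (c p) * ((M p)%:R `^ q * u)).
    rewrite MqV mulr1 ler_pdivrMr // [leRHS]mulrC ler_pdivlMr ?mulr_gt0 //.
    apply: le_trans cB; rewrite /B (_ : 4 ^+ p = 2 ^+ p * 2 ^+ p); last first.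
      by rewrite -exprMn -natrM.
    by rewrite le_eqVlt; apply/orP; left; apply/eqP; ring.
  by rewrite -!mulrA; congr (_ * (_ * _)); rewrite mulrCA.
have vt : (Num.truncn (v p))%:R <= v p by rewrite truncn_le.
rewrite natrD natrX mulrDl.
apply: (@le_trans _ _ ((2 * 2 ^+ p)^-1 + (2 * 2 ^+ p)^-1)).
  by apply: lerD => //; apply: le_trans av; rewrite ler_wpM2r.
by rewrite invfM -mulrDl -exprVn [_ + _](_ : _ = 1) ?mul1r //; lra.
Qed.

End StageChoice.

(** * Averages along a perturbed sequence *)

Lemma ler_sum_subset (R : numDomainType) (s1 s2 : seq nat) (h : nat -> R) :
  uniq s1 -> {subset s1 <= s2} -> (forall k, 0 <= h k) ->
  \sum_(k <- s1) h k <= \sum_(k <- s2) h k.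
Proof.
move=> + + h0; elim: s1 s2 => [|x s1 ih] s2 /=.
  by rewrite big_nil sumr_ge0.
case/andP => xs1 us1 sub; have xs2 : x \in s2 by apply: sub; rewrite mem_head.
rewrite (perm_big _ (perm_to_rem xs2)) !big_cons lerD2l ih // => k ks1.
have := sub k; rewrite inE ks1 orbT => /(_ isT).
rewrite (perm_mem (perm_to_rem xs2)) inE => /predU1P[kx|//].
by rewrite -kx ks1 in xs1.
Qed.

Section PerturbedAverages.
Variables (a b : nat -> nat).
Hypotheses (sa : int_sequence a) (sb : int_sequence b).
Hypothesis ab : range a `<=` range b.

Let A := range a.
Let E := range b `\` A.

Lemma sum_elements_belowU (V : nmodType) (u : nat -> V) N :
  \sum_(k <- elements_below (range b) N) u k =
  \sum_(k <- elements_below A N) u k + \sum_(k <- elements_below E N) u k.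
Proof.
rewrite /elements_below !big_filter (bigID (mem A)) /=; congr (_ + _).
  apply: eq_bigl => k; apply/andP/idP => [[]//|kA]; split => //.
  by rewrite inE; apply: ab; rewrite -inE.
by apply: eq_bigl => k; rewrite in_setD.
Qed.

Lemma size_elements_belowU N :
  size (elements_below (range b) N) =
  (size (elements_below A N) + size (elements_below E N))%N.
Proof. by rewrite -!sum1_size sum_elements_belowU. Qed.

Variable R : realType.

Lemma size_elements_below_cvgy (g : nat -> nat) : (forall N, (N <= g N)%N) ->
  size (elements_below A (g N)) @[N --> \oo] --> \oo.
Proof.
move=> gN; apply/cvgnyPge => c; exists (a c) => // N /= aN.
rewrite -[c](size_elements_below_seq c sa).
by apply: elements_below_leq; exact: leq_trans (gN N).
Qed.

(** Let [s] and [t] count the elements of [A] and [E] below [b N]. Then [N = s + t], and the average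
    along [b] is [(1 + t / s)^-1] times the sum of the average of the first [s] terms along [a] and
    of the extra terms divided by [s]. *)
Lemma perturbed_average_cvg (u : nat -> R) :
  (size (elements_below E N))%:R / (size (elements_below A N))%:R
    @[N --> \oo] --> (0 : R) ->
  (\sum_(k <- elements_below E N) `|u k|) / (size (elements_below A N))%:R
    @[N --> \oo] --> (0 : R) ->
  cvg (N%:R^-1 * \sum_(0 <= n < N) u (a n) @[N --> \oo]) ->
  cvg (N%:R^-1 * \sum_(0 <= n < N) u (b n) @[N --> \oo]).
Proof.
move=> E_small Eu_small /cvg_ex[l cvg_a].
pose s N := size (elements_below A N).
pose t N := size (elements_below E N).
pose e N := \sum_(k <- elements_below E N) u k.
have bN N : (N <= b N)%N by apply/ltnW/int_sequence_ge.
have b_cvg : b N @[N --> \oo] --> \oo.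
  by apply/cvgnyPge => c; exists c => // N /= cN; exact: leq_trans (bN N).
have s_cvg : s (b N) @[N --> \oo] --> \oo by exact: size_elements_below_cvgy.
have ratio : (1 + (t (b N))%:R / (s (b N))%:R)^-1 @[N --> \oo] --> (1 : R).
  rewrite -[X in _ --> X]invr1; apply: cvgV; first exact: oner_neq0.
  rewrite -[X in _ --> X]addr0; apply: cvgD; first exact: cvg_cst.
  exact: (cvg_comp _ _ b_cvg E_small).
have err : e (b N) / (s (b N))%:R @[N --> \oo] --> (0 : R).
  have {}Eu_small := cvg_comp _ _ b_cvg Eu_small.
  apply/norm_cvg0P.
  apply: (squeeze_cvgr _ (cvg_cst _) Eu_small); apply: nearW => N /=.
  rewrite normr_ge0 /= normrM normfV normr_nat ler_wpM2r ?invr_ge0 //.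
  exact: ler_norm_sum.
have main : (s (b N))%:R^-1 * \sum_(0 <= n < s (b N)) u (a n) @[N --> \oo] --> l.
  exact: (cvg_comp _ _ s_cvg cvg_a).
apply: (cvgP (1 * (l + 0))).
apply: cvg_trans (cvgM ratio (cvgD main err)).
apply: near_eq_cvg.
have s_gt0 : \forall N \near \oo, (0 < s (b N))%N by move/cvgnyPge : s_cvg; apply.
near=> N.
have s0 : (0 < s (b N))%N by near: N.
have s0R : (s (b N))%:R != 0 :> R by rewrite pnatr_eq0 -lt0n.
have NE : N%:R = (s (b N))%:R + (t (b N))%:R :> R.
  by rewrite -natrD -size_elements_belowU size_elements_below_seq.
have sumE : \sum_(0 <= n < N) u (b n) =
    \sum_(0 <= n < s (b N)) u (a n) + e (b N).
  rewrite -[N in LHS](size_elements_below_seq N sb) -sum_elements_below //.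
  by rewrite sum_elements_belowU sum_elements_below.
have N0 : (s (b N))%:R + (t (b N))%:R != 0 :> R.
  by rewrite -natrD pnatr_eq0 -lt0n addn_gt0 s0.
rewrite sumE NE /= fctE; field.
by rewrite s0R N0.
Unshelve. all: by end_near. Qed.

End PerturbedAverages.

Section ExtraBlocks.
Variables (A : set nat) (n e : nat -> nat) (blk : nat -> seq nat).
Hypotheses (blk_gt0 : forall j, (0 < size (blk j))%N)
  (blk_in : forall j k, k \in blk j -> (n j <= k < e j)%N)
  (en : forall j, (e j <= n j.+1)%N).

Definition blocks_upto j := flatten [seq blk i | i <- iota 0 j.+1].

Lemma size_blocks_upto j :
  size (blocks_upto j) = (\sum_(i < j.+1) size (blk i))%N.
Proof.
rewrite size_flatten /shape -map_comp sumnE big_map.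
by rewrite -(big_mkord xpredT (fun i => size (blk i))) /index_iota subn0.
Qed.

Lemma blocks_increasing : {homo n : i j / (i < j)%N}.
Proof.
apply: homo_ltn => [y x z|j]; first exact: ltn_trans.
apply: leq_trans (en j); case: (blk j) (blk_gt0 j) (blk_in (j := j)) => // k l _.
by move=> /(_ k); rewrite mem_head => /(_ isT) /andP[]; exact: leq_ltn_trans.
Qed.

Let D := A `|` \bigcup_j [set k | k \in blk j].

Lemma extra_below_sub j N : (N <= n j.+1)%N ->
  {subset elements_below (D `\` A) N <= blocks_upto j}.
Proof.
move=> Nn k; rewrite mem_elements_below => /andP[]; rewrite inE.
move=> [[//|[i _ /= ki]] _] kN; apply/flattenP; exists (blk i) => //.
apply: map_f; rewrite mem_iota /= add0n ltnS leqNgt; apply/negP => ji.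
have /andP[nk _] := blk_in ki.
have nji : (n j.+1 <= n i)%N.
  by move: ji; rewrite leq_eqVlt => /predU1P[->//|/blocks_increasing/ltnW].
by have := leq_trans nji nk; rewrite leqNgt (leq_trans kN Nn).
Qed.

(** If [n j <= N <= n j.+1], the extra elements below [N] lie in the blocks up to the [j]-th and
    [s (n j) <= s N], so the quotient at [N] is at most that of [j]. *)
Lemma extra_sum_cvg0 (R : realType) (h : nat -> R) (s : nat -> nat) :
  {homo s : i j / (i <= j)%N} -> (forall k, 0 <= h k) ->
  (forall j, (0 < s (n j))%N) ->
  (\sum_(k <- blocks_upto j) h k) / (s (n j))%:R @[j --> \oo] --> (0 : R) ->
  (\sum_(k <- elements_below (D `\` A) N) h k) / (s N)%:R
    @[N --> \oo] --> (0 : R).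
Proof.
move=> s_mono h0 s0 hcvg; apply/cvgr0Pnorm_lt => eps eps0.
have /cvgr0Pnorm_lt/(_ _ eps0)[j0 _ j0P] := hcvg.
exists (n j0) => // N /= nN.
have [j [j0j njN Nnj]] : exists j, [/\ (j0 <= j)%N, (n j <= N)%N & (N <= n j.+1)%N].
  have n_ge i : (i <= n i)%N.
    by elim: i => // i ih; exact: leq_ltn_trans ih (blocks_increasing (ltnSn i)).
  have exj : exists i, (N <= n i.+1)%N by exists N; apply: leq_trans (n_ge _).
  (* If the least index is at most [j0], then [j0] itself serves, as [n j0 <= N]. *)
  exists (maxn j0 (ex_minn exj)); case: ex_minnP => i Ni imin.
  have [ij|ji] := leqP i j0.
    split=> //; apply: leq_trans Ni _.
    by move: ij; rewrite leq_eqVlt => /predU1P[->//|ij]; exact/ltnW/blocks_increasing.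
  split=> //; first exact: ltnW.
  case: i Ni imin ji => // i _ imin _; rewrite leqNgt; apply/negP => /ltnW /imin.
  by rewrite ltnn.
have := j0P j j0j; rewrite /= !ger0_norm ?divr_ge0 ?sumr_ge0 //.
apply: le_lt_trans; apply: ler_pM; rewrite ?sumr_ge0 ?invr_ge0 //.
  by apply: ler_sum_subset => //; [exact: elements_below_uniq | exact: extra_below_sub].
rewrite lef_pV2 ?posrE ?ltr0n //; first by rewrite ler_nat s_mono.
exact: leq_trans (s_mono _ _ njN).
Qed.

End ExtraBlocks.

(** * Functions with countably many levels *)

Section LevelFunctions.
Context (R : realType) (d : measure_display) (X : measurableType d).

Lemma measurable_level_function (F : nat -> set X) (c : nat -> R) :
  (forall p, measurable (F p)) -> trivIset [set: nat] F ->
  exists f : X -> R, [/\ measurable_fun [set: X] f,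
    forall p x, F p x -> f x = c p &
    forall x, (forall p, ~ F p x) -> f x = 0].
Proof.
move=> mF trivF.
have fex x : exists y, (forall p, F p x -> y = c p) /\ ((forall p, ~ F p x) -> y = 0).
  have [[p Fp]|nF] := pselect (exists p, F p x).
    exists (c p); split=> [p' Fp'|/(_ p)//]; congr c.
    by apply: (trivF p p' I I); exists x.
  exists 0; split=> // p Fp; exfalso; apply: nF; by exists p.
have [f fP] := choice fex; exists f; split=> [_ Y mY|p x Fp|x nF].
- rewrite setTI (_ : f @^-1` Y = \bigcup_(p in [set p | Y (c p)]) F p `|`
      ((~` \bigcup_p F p) `&` [set _ | Y 0])).
    apply: measurableU; first exact: bigcup_measurable.
    apply: measurableI; first by apply: measurableC; exact: bigcupT_measurable.
    have [Y0|Y0] := pselect (Y 0).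
      by rewrite [X in measurable X](_ : _ = setT) //; apply/seteqP; split.
    by rewrite [X in measurable X](_ : _ = set0) //; apply/seteqP; split.
  apply/seteqP; split=> x /=.
    have [fF f0] := fP x; have [[p Fp]|nF] := pselect (exists p, F p x).
      by rewrite (fF p Fp) => Ycp; left; exists p.
    rewrite f0 => [Y0|p Fp]; last by apply: nF; exists p.
    by right; split=> // -[p _ Fp]; apply: nF; exists p.
  case=> [[p /= Yp /(fP x).1 ->]//|[nF Y0]].
  by rewrite (fP x).2 // => p Fp; apply: nF; exists p.
- exact: (fP x).1.
- exact: (fP x).2.
Qed.

(* [f] vanishes where infinitely many [E p] overlap, which keeps its values
   among [0] and the [c p]. *)
Lemma measurable_top_level (E : nat -> set X) (c : nat -> R) :
  (forall p, measurable (E p)) -> {homo c : i j / (i <= j)%N >-> i <= j} ->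
  exists f : X -> R, [/\ measurable_fun [set: X] f,
    forall x, f x = 0 \/ exists2 p, E p x & f x = c p &
    forall p x, E p x -> ~ lim_sup_set E x -> c p <= f x].
Proof.
move=> mE c_mono.
pose F p := E p `\` \bigcup_(r in [set r | (p < r)%N]) E r.
have mF p : measurable (F p) by apply: measurableD => //; exact: bigcup_measurable.
have trivF : trivIset [set: nat] F.
  apply/trivIsetP => p p' _ _.
  wlog pp' : p p' / (p < p')%N => [hw ne|_].
    case: (ltngtP p p') => [pp'|p'p|epp'].
    - exact: hw.
    - by rewrite setIC; apply: hw => //; rewrite eq_sym.
    - by rewrite epp' eqxx in ne.
  by rewrite -subset0 => x [[_ nE] [Ep' _]]; apply: nE; exists p'.
have [f [mf fF f0]] := measurable_level_function c mF trivF.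
exists f; split=> // [x|p x Ep nlim].
  have [[p Fp]|nF] := pselect (exists p, F p x).
    by right; exists p; [case: Fp | exact: fF].
  by left; apply: f0 => p Fp; apply: nF; exists p.
(* Off the upper limit, [x] lies in finitely many [E k]; at the largest such [k],
   [f x = c k >= c p]. *)
have [n nE] : exists n, forall k, E k x -> (k <= n)%N.
  apply: contrapT => nex; apply: nlim => n _; apply: contrapT => nE.
  apply: nex; exists n => k Ek; rewrite leqNgt; apply/negP => nk.
  by apply: nE; exists k => //=; exact: ltnW.
have exE : exists k, `[< E k x >] by exists p; exact/asboolP.
have bE k : `[< E k x >] -> (k <= n)%N by move/asboolP/nE.
case: (ex_maxnP exE bE) => k /asboolP Ek kmax.
rewrite (fF k); first by apply/c_mono/kmax/asboolP.
split=> // -[r /= kr Er]; have := kmax r (asboolT Er).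
by rewrite leqNgt kr.
Qed.

Lemma measurable_Lq_phi (q : R) (phi : R -> R) (f : X -> R) :
  (forall x, 0 < phi x) -> {homo phi : x y / x <= y} ->
  measurable_fun [set: X] f ->
  measurable_fun [set: X] (fun x => `|f x| `^ q / phi `|f x|).
Proof.
move=> phi0 phi_mono mf; apply: measurable_funM.
  by apply: (measurableT_comp (measurable_powR _)); exact: measurableT_comp.
apply: (@measurableT_comp _ _ _ _ _ _ (fun y => (phi y)^-1)); last first.
  exact: measurableT_comp.
(* Measurability comes from monotonicity: [- 1 / phi] is nondecreasing. *)
rewrite (_ : (fun y => _) = -%R \o (fun y => - (phi y)^-1)); last first.
  by apply/funext => y /=; rewrite opprK.
apply: measurableT_comp => //; apply: nondecreasing_measurable => // y z yz.
by rewrite lerN2 lef_pV2 ?posrE // phi_mono.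
Qed.

(** The integrand vanishes where [f] does, and elsewhere is dominated by the sum over [p] of
    [c p ^ q / phi (c p)] times the indicator of [E p], which is integrated term by term. *)
Lemma level_function_Lq_phi (m : probability X R) (q : R) (phi : R -> R)
    (E : nat -> set X) (c r : nat -> R) (f : X -> R) (B : R) :
  q != 0 -> (forall x, 0 < phi x) -> {homo phi : x y / x <= y} ->
  (forall p, measurable (E p)) -> measurable_fun [set: X] f ->
  (forall p, 0 <= c p) -> (forall p, m (E p) <= (r p)%:E)%E ->
  (forall x, f x = 0 \/ exists2 p, E p x & f x = c p) ->
  (forall n, \sum_(0 <= p < n) (c p `^ q / phi (c p)) * r p <= B) ->
  Lq_phi_space q phi m f.
Proof.
move=> q0 phi0 phi_mono mE mf c0 E_le f_levels sum_le; split => //.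
pose w p := c p `^ q / phi (c p).
have w0 p : 0 <= w p by rewrite divr_ge0 ?powR_ge0 // ltW.
pose g p x := ((w p)%:E * (\1_(E p) x)%:E)%E : \bar R.
have g0 p x : (0 <= g p x)%E by rewrite /g -EFinM lee_fin mulr_ge0.
have m1 p : measurable_fun [set: X] (fun x => (\1_(E p) x : R)%:E).
  by apply/measurable_EFinP; exact: measurable_indic.
have mg p : measurable_fun [set: X] (g p) by exact: measurable_funeM.
apply: (@le_lt_trans _ _ B%:E); last exact: ltry.
apply: (@le_trans _ _ (\int[m]_x (\sum_(p <oo) g p x))%E).
  apply: ge0_le_integral => //.
  - by move=> x _; rewrite lee_fin divr_ge0 ?powR_ge0 // ltW.
  - by apply/measurable_EFinP; exact: measurable_Lq_phi.
  - by apply: ge0_emeasurable_sum => // p _; exact: mg.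
  move=> x _; have [->|[p Ep ->]] := f_levels x.
    by rewrite normr0 powR0 // mul0r nneseries_ge0.
  rewrite ger0_norm //.
  have g_sum : (\sum_(0 <= k < p.+1) g k x <= \sum_(k <oo) g k x)%E.
    by apply: nneseries_lim_ge => k _ _; exact: g0.
  apply: le_trans g_sum; rewrite big_nat_recr //= {2}/g indicE mem_set // mule1.
  by rewrite leeDr // sume_ge0.
rewrite integral_nneseries //.
apply: lime_le; first by apply: is_cvg_nneseries => p _ _; exact: integral_ge0.
apply: nearW => n; apply: (@le_trans _ _ (\sum_(0 <= p < n) (w p * r p)%:E)%E).
  apply: lee_sum => p _.
  rewrite ge0_integralZl_EFin // integral_indic // setIT.
  rewrite (EFinM (w p)).
  by apply: lee_wpmul2l; [rewrite lee_fin; exact: w0 | exact: E_le].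
by rewrite sumEFin lee_fin.
Qed.

End LevelFunctions.

(** * Borel-Cantelli and other preparations *)

Lemma lim_sup_set_negligible (R : realType) (d : measure_display)
    (X : measurableType d) (m : probability X R)
    (F : nat -> set X) (r : nat -> R) (B : R) :
  (forall p, measurable (F p)) -> (forall p, m (F p) <= (r p)%:E)%E ->
  (forall n, \sum_(0 <= p < n) r p <= B) ->
  m.-negligible (lim_sup_set F).
Proof.
move=> mF F_le r_le; have mlim : measurable (lim_sup_set F).
  apply: bigcapT_measurable => n; exact: bigcup_measurable.
apply/negligibleP => //; apply: lim_sup_set_cvg0 => //.
apply: (@le_lt_trans _ _ B%:E); last exact: ltry.
apply: lime_le; first by apply: is_cvg_nneseries.
apply: nearW => n; apply: (@le_trans _ _ (\sum_(0 <= p < n) (r p)%:E)%E).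
  by apply: lee_sum => p _; exact: F_le.
by rewrite sumEFin lee_fin.
Qed.

Lemma ereal_sup_unbounded (R : realType) (S : set (\bar R)) :
  (forall n : nat, exists2 y, S y & (n%:R%:E <= y)%E) -> ereal_sup S = +oo%E.
Proof.
move=> S_unb; apply/eqyP => A A0.
have [y Sy Ay] := S_unb (Num.truncn A).+1.
apply: le_trans (ereal_sup_ubound Sy); apply: le_trans Ay.
rewrite lee_fin; exact/ltW/truncnS_gt.
Qed.

Lemma zero_density_sparse (R : realType) (A : set nat) : ~ A 0%N ->
  zero_density R A -> forall L, exists n1, forall n, (n1 <= n)%N ->
  (L * size (elements_below A n) <= n)%N.
Proof.
(* The successor keeps the threshold positive when [L = 0]. *)
move=> A0 dA L; have L0 : 0 < (L.+1%:R)^-1 :> R by rewrite invr_gt0.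
have /cvgr0Pnorm_lt/(_ _ L0)[n1 _ n1P] := dA.
exists n1.+1 => n n1n; have := n1P n (ltnW n1n).
have n0 : 0 < n%:R :> R by rewrite ltr0n (leq_trans _ n1n).
rewrite /= card_below_size // ger0_norm ?divr_ge0 //.
rewrite ltr_pdivrMr // mulrC ltr_pdivlMr // -natrM ltr_nat mulnC => /ltnW.
by apply: leq_trans; rewrite leq_mul2r leqnSn orbT.
Qed.

Lemma Lfun_measurable (R : realType) (d : measure_display)
    (X : measurableType d) (m : probability X R) (p : \bar R) (f : X -> R) :
  f \in Lfun m p -> measurable_fun [set: X] f.
Proof. by rewrite inE => /andP[]; rewrite inE. Qed.

(** Dividing by [phi >= 1] only decreases the integrand. The inclusion lets the goodness of [a] be
    applied to functions in [L^q]. *)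
Lemma Lq_sub_Lq_phi (R : realType) (q : R) (phi : R -> R)
    (d : measure_display) (X : measurableType d) (m : probability X R) :
  1 <= q -> (forall x, 1 <= phi x) -> {homo phi : x y / x <= y} ->
  Lq_space q m `<=` Lq_phi_space q phi m.
Proof.
move=> q1 phi1 phi_mono f fL.
have mf : measurable_fun [set: X] f.
  exact: Lfun_measurable fL.
split=> //.
have /integrableP[mfq] := Lfun_integrable q1 fL.
apply: le_lt_trans; apply: ge0_le_integral => //.
- by move=> x _; rewrite lee_fin divr_ge0 ?powR_ge0 // (le_trans ler01).
- apply/measurable_EFinP; apply: measurable_Lq_phi => //.
  by move=> x; rewrite (lt_le_trans ltr01).
- exact: measurableT_comp.
move=> x _; rewrite gee0_abs ?lee_fin ?powR_ge0 //.
by rewrite ler_pdivrMr ?(lt_le_trans ltr01) // ler_peMr ?powR_ge0.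
Qed.

(** * Construction of the perturbation and its two properties *)

Theorem theorem1 (R : realType) (q : R) (phi : R -> R) (a : nat -> nat)
  (q_gt1 : 1 < q)
  (phi_gt0 : forall x, 0 < phi x)
  (phi_unbounded : forall M : R, exists x, M < phi x)
  (phi_eq1 : forall x, x <= 1 -> phi x = 1)
  (phi_incr : forall x y, 1 <= x -> x < y -> phi x < phi y)
  (phi_growth : phi x / `|x| `^ q @[x --> +oo] --> (0 : R))
  (a_seq : int_sequence a)
  (a_density : zero_density R (range a))
  (a_good : universally_good (Lq_phi_space q phi) a) :
  exists b : nat -> nat,
    [/\ int_sequence b,
        perturbation_of R (range b) (range a),
        universally_good (Lq_space q) b &
        universally_sweeping_out (Lq_phi_space q phi) b].
Proof.
pose A := range a; pose s N := size (elements_below A N).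
have q0 : 0 < q by rewrite (lt_trans ltr01).
have A0 : ~ A 0%N.
  by move=> [n _ an0]; have := a_seq.1 n; rewrite an0.
have phi_mono := phi_nondecreasing phi_eq1 phi_incr.
have s_mono : {homo s : i j / (i <= j)%N} by move=> i j; exact: elements_below_leq.
have s_unb c : exists n, (c <= s n)%N.
  by exists (a c); rewrite /s size_elements_below_seq.
have [M [K [M0 M_mono K_ge K_phi K_M]]] :=
  stage_parameters q_gt1 phi_gt0 phi_unbounded phi_eq1 phi_incr.
have K0 p : (0 < K p)%N.
  by rewrite -(ltr0n R) (lt_le_trans _ (K_ge p)) // exprn_gt0.
(* Block [j] uses [M p], [K p] and the residue [r], where [st j = (p, r)]. *)
pose st := stage K.
have [n [e [blk blkP]]] := block_construction s_mono s_unb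
  (zero_density_sparse A0 a_density) (fun j => M0 (st j).1) (stage_lt K0).
have blk_gt0 j : (0 < size (blk j))%N by have [[]] := blkP j.
have blk_in j k : k \in blk j -> (n j <= k < e j)%N.
  by have [_ h _ _ _] := blkP j => /h[].
have en j : (e j <= n j.+1)%N by have [] := blkP j.
pose D := A `|` \bigcup_j [set k | k \in blk j].
have sn_gt0 j : (0 < s (n j))%N.
  have [_ _ _ h _] := blkP j; apply: leq_trans h.
  by rewrite muln_gt0 M0 big_ord_recr /= addn_gt0 blk_gt0 orbT.
have n_gt0 j : (0 < n j)%N.
  by rewrite lt0n; apply: contraTneq (sn_gt0 j) => ->.
have D0 : ~ D 0%N.
  move=> [//|[j _ /= /blk_in /andP[]]]; by rewrite leqNgt n_gt0.
have [b sb bD] : exists2 b, int_sequence b & range b = D.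
  apply: enumerate_infinite D0 _ => c; exists (a c); first by left; exists c.
  exact: int_sequence_ge.
have AD : A `<=` D by move=> k Ak; left.
have ab : range a `<=` range b by rewrite bD.
have size_upto j : size (blocks_upto blk j) = (\sum_(i < j.+1) size (blk i))%N.
  exact: size_blocks_upto.
have upto_le j : (M (st j).1 * size (blocks_upto blk j) <= s (n j))%N.
  by rewrite size_upto; have [] := blkP j.
have M_sum J : \sum_(0 <= j < J) (M (st j).1)%:R^-1 `^ q <= 2 :> R.
  by apply: (sum_stage_le2 K0 (w := fun p => (M p)%:R^-1 `^ q)) => p; rewrite ?powR_ge0.
have M_cvg : (M (st j).1)%:R^-1 @[j --> \oo] --> (0 : R).
  exact: powR_sum_bounded_cvg0 q0 _ M_sum.
have extra_cvg0 (h : nat -> R) : (forall k, 0 <= h k) ->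
    (\sum_(k <- blocks_upto blk j) h k) / (s (n j))%:R @[j --> \oo] --> (0 : R) ->
    (\sum_(k <- elements_below (range b `\` A) N) h k) / (s N)%:R
      @[N --> \oo] --> (0 : R).
  by rewrite bD => h0; exact: (extra_sum_cvg0 A blk_gt0 blk_in en s_mono h0 sn_gt0).
have E_small : (size (elements_below (range b `\` A) N))%:R / (s N)%:R
    @[N --> \oo] --> (0 : R).
  have sum1 l : \sum_(k <- l) 1 = (size l)%:R :> R.
    by rewrite -sum1_size natr_sum.
  rewrite (_ : (fun N => _) = fun N =>
      (\sum_(k <- elements_below (range b `\` A) N) 1) / (s N)%:R); last first.
    by apply/funext => N; rewrite sum1.
  (* For the constant function 1 the block sums are sizes, and the quotients are at most [1 / M]. *)
  apply: extra_cvg0 => //.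
  apply: (squeeze_cvgr _ (cvg_cst _) M_cvg); apply: nearW => j /=.
  rewrite sum1 divr_ge0 //= ler_pdivrMr ?ltr0n // mulrC ler_pdivlMr ?ltr0n //.
  by rewrite -natrM ler_nat mulnC.
exists b; split=> //.
- rewrite /perturbation_of (_ : (fun N => _) = fun N =>
      (size (elements_below (range b `\` A) N))%:R / (s N)%:R) //.
  apply/funext => N; rewrite bD.
  have -> : D `\` range a `|` range a `\` D = D `\` A.
    by rewrite (_ : range a `\` D = set0) ?setU0 // setD_eq0.
  by rewrite !card_below_size // => -[].
- move=> d X m T sys f fL; have [_ mT _] := sys.
  have mf : measurable_fun [set: X] f.
    exact: Lfun_measurable fL.
  have fphi : Lq_phi_space q phi m f.
    apply: Lq_sub_Lq_phi fL; rewrite ?(ltW q_gt1) //.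
    exact: phi_ge1 phi_eq1 phi_incr.
  have small_extra := orbit_sum_cvg0 mT (ltW q_gt1) mf fL
    (fun j => conj (sn_gt0 j) (conj (M0 (st j).1) (upto_le j))) M_sum.
  have := a_good _ _ _ _ sys _ fphi.
  apply: filterS2 small_extra => x small_x cvg_x.
  apply: (perturbed_average_cvg (u := fun k => f (iter k T x))
    a_seq sb ab E_small _ cvg_x).
  by apply: extra_cvg0; [move=> k; exact: normr_ge0 | exact: small_x].
move=> d X m T sys; have [_ mT _] := sys.
have [jx jxP] : exists jx : nat -> nat -> nat, forall p r, (r < K p)%N ->
    st (jx p r) = (p, r).
  (* The choice ranges over all pairs, with the dummy value 0 when [r >= K p]. *)
  have jex pr : exists j, (pr.2 < K pr.1)%N -> st j = pr.
    have [lt|ge] := ltnP pr.2 (K pr.1); last by exists 0%N.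
    by have [j jE] := stage_reached K0 lt; exists j; case: pr {lt} jE.
  have [jx jxP] := choice jex; exists (fun p r => jx (p, r)) => p r rK.
  exact: (jxP (p, r)).
(* The range of the tower has to contain a block of stage [p] for every residue. *)
pose L p := (\max_(r < K p) e (jx p r))%N.
pose half p : R := 2^-1 ^+ p.
have half0 p : 0 < half p by rewrite exprn_gt0 // invr_gt0.
have tower p : exists EB : set X * set X, [/\ measurable EB.1, measurable EB.2,
    (m EB.1 <= ((K p)%:R^-1)%:E)%E, (m EB.2 <= (half p)%:E)%E &
    forall x, ~ EB.2 x -> exists2 r, (r < K p)%N &
      forall k, (k <= L p)%N -> (k %% K p)%N = r -> EB.1 (iter k T x)].
  by have [E [B h]] := residue_tower sys (L p) (K0 p) (half0 p); exists (E, B).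
have [EB EBP] := choice tower.
pose E p := (EB p).1; pose B p := (EB p).2.
pose c p : R := 2 ^+ p * (M p)%:R.
have mE p : measurable (E p) by have [] := EBP p.
have mB p : measurable (B p) by have [] := EBP p.
have c_mono : {homo c : i j / (i <= j)%N >-> i <= j}.
  move=> i j ij; apply: ler_pM; rewrite ?exprn_ge0 // ?ler_nat ?M_mono //.
  by rewrite ler_weXn2l // ler1n.
have c0 p : 0 <= c p by rewrite mulr_ge0 // exprn_ge0.
have [f [mf f_levels f_ge]] := measurable_top_level mE c_mono.
have f0 x : 0 <= f x by have [->|[p _ ->]] := f_levels x.
have halfE p : half p = (2 ^+ p)^-1 by rewrite /half exprVn.
have pow0 p : 0 < 2 ^+ p :> R by rewrite exprn_gt0.
have KR0 p : 0 < (K p)%:R :> R by rewrite ltr0n.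
have KV_le J : \sum_(0 <= p < J) (K p)%:R^-1 <= 2 :> R.
  apply: le_trans (sum_geometric_half_le2 R J); apply: ler_sum => p _.
  by rewrite -/(half p) halfE lef_pV2 ?posrE.
exists f.
  apply: (@level_function_Lq_phi _ _ _ m q phi E c (fun p => (K p)%:R^-1) f 2) => //.
  - by rewrite gt_eqF.
  - by move=> p; have [] := EBP p.
  move=> J; apply: le_trans (sum_geometric_half_le2 R J); apply: ler_sum => p _.
  by rewrite -/(half p) halfE ler_pdivrMr // [leRHS]mulrC ler_pdivlMr // mulrC K_phi.
have limE0 : m.-negligible (lim_sup_set E).
  apply: (lim_sup_set_negligible mE (r := fun p => (K p)%:R^-1)) KV_le => p.
  by have [] := EBP p.
have limB0 : m.-negligible (lim_sup_set B).
  by apply: (lim_sup_set_negligible mB (r := half))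
    (sum_geometric_half_le2 R) => p; have [] := EBP p.
(* Exceptional points lie in infinitely many bad sets, or have an orbit entering the upper limit of
   the [E p], where [f] has no lower bound [c p]. *)
apply: (@negligibleS _ _ _ _
    (lim_sup_set B `|` \bigcup_k (iter k T @^-1` lim_sup_set E))); last first.
  apply: negligibleU => //; apply: negligible_bigcup => k.
  exact: (negligible_preimage_iter mT).
move=> x; apply: contra_notP => /not_orP[nB nE].
have f_big p k : E p (iter k T x) -> c p <= f (iter k T x).
  by move=> Ep; apply: f_ge Ep _ => lim; apply: nE; exists k.
apply: ereal_sup_unbounded => l.
(* The factor 12 offsets the one in [block_construction]: in the end [12 l <= p < 2 ^ p]. *)
have [p pl nBp] : exists2 p, (12 * l <= p)%N & ~ B p x.
  apply: contrapT => nex; apply: nB => i _; apply: contrapT => nBi.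
  apply: nex; exists (maxn (12 * l) i); first exact: leq_maxl.
  by move=> Bx; apply: nBi; exists (maxn (12 * l) i) => //=; exact: leq_maxr.
have [_ _ _ _ /(_ x nBp)[r rK rE]] := EBP p.
pose j := jx p r; have jE : st j = (p, r) by exact: jxP.
have [[blk_uniq _] blk_res _ _ blk_large] := blkP j.
rewrite -size_upto -/(st j) jE /= in blk_large.
have f_blk k : k \in blk j -> c p <= f (iter k T x).
  move=> kj; have [/andP[_ ke] kr] := blk_res k kj; apply: f_big; apply: rE.
    apply: leq_trans (ltnW ke) _.
    exact: (leq_bigmax (F := fun r : 'I_(K p) => e (jx p r)) (Ordinal rK)).
  by move: kr; rewrite -/(st j) jE.
(* The average stops at the end of block [j], which makes up at least a fraction [1 / (12 M p)] of
   its terms. *)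
pose N := size (elements_below (range b) (e j)).
have blk_sub : {subset blk j <= elements_below (range b) (e j)}.
  move=> k kj; rewrite mem_elements_below bD; have /andP[_ ->] := blk_in j k kj.
  by rewrite andbT inE; right; exists j.
have N0 : (0 < N)%N.
  apply: leq_trans (blk_gt0 j) _; exact: uniq_leq_size.
have N_le : (N <= 12 * M p * size (blk j))%N.
  apply: leq_trans blk_large; rewrite /N (size_elements_belowU ab) leq_add2l bD.
  apply: uniq_leq_size; first exact: elements_below_uniq.
  exact: (extra_below_sub (A := A) blk_gt0 blk_in en).
exists (seq_average T b f x N)%:E; first by exists N.
rewrite lee_fin /seq_average /N.
rewrite -(sum_elements_below (fun k => f (iter k T x)) _ sb) -/N.
apply: (@le_trans _ _ (N%:R^-1 * \sum_(k <- blk j) f (iter k T x))); last first.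
  by rewrite ler_wpM2l ?invr_ge0 //; apply: ler_sum_subset.
have NR0 : 0 < N%:R :> R by rewrite ltr0n.
rewrite mulrC ler_pdivlMr //.
apply: (@le_trans _ _ (c p * (size (blk j))%:R)); last first.
  rewrite -sum1_size natr_sum mulr_sumr; rewrite big_seq [leRHS]big_seq.
  by apply: ler_sum => k kj; rewrite mulr1 f_blk.
apply: (@le_trans _ _ (l%:R * (12 * M p * size (blk j))%:R)).
  by rewrite ler_wpM2l // ler_nat.
rewrite /c !natrM !mulrA ler_wpM2r // ler_wpM2r // -natrM -natrX ler_nat mulnC.
exact: leq_trans pl (ltnW (ltn_expl _ _)).
Qed.
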